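(* Let $F$ be a $3$-graph. If $F$ is $3$-partite, then there is $\varepsilon=\varepsilon(F)>0$ such that $\mathrm{co^+ex}(n,F)\le O(n^{1-\varepsilon})$ as $n\to\infty$. Otherwise, $\mathrm{co^+ex}(n,F)=\Theta(n)$ as $n\to\infty$. (Implied constants may depend on $F$.)
   Context: A $3$-graph is a finite $3$-uniform hypergraph. It is $3$-partite if its vertex set can be partitioned into three classes such that each edge intersects each class in at most one vertex. The minimum positive co-degree $\delta_2^+(H)$ of a non-empty $3$-graph $H$ is the maximum $k$ such that every pair of vertices contained in some edge of $H$ is contained in at least $k$ distinct edges of $H$; by convention it is $0$ if $H$ has no edges. A hypergraph is $F$-free if it has no (not necessarily induced) subhypergraph isomorphic to $F$. $\mathrm{co^+ex}(n,F)$ is the maximum of $\delta_2^+(H)$ over all $n$-vertex $F$-free $3$-graphs $H$ (taken to be $0$ if there are none). *)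

(* Defs.v *)
From HB Require Import structures.
From mathcomp Require Import all_boot all_order all_algebra.
From mathcomp Require Import all_classical all_reals all_analysis.

Set Implicit Arguments.
Unset Strict Implicit.
Unset Printing Implicit Defensive.

Record hypergraph3 (V : finType) := Hypergraph3 {
  edges :> {set {set V}};
  edges_card3 : [forall e in edges, #|e| == 3] }.

HB.instance Definition _ (V : finType) := [isSub for @edges V].
HB.instance Definition _ (V : finType) := [Finite of hypergraph3 V by <:].

(* Classes are the fibres of c, so some of them may be empty. *)
Definition tripartite (V : finType) (H : hypergraph3 V) : bool :=
  [exists c : {ffun V -> 'I_3},
    [forall e in edges H, forall i : 'I_3, #|e :&: c @^-1: [set i]| <= 1]].

Definition codegree (V : finType) (H : hypergraph3 V) (P : {set V}) : nat :=
  #|[set e in edges H | P \subset e]|.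

Definition positive_codegree_ge (V : finType) (H : hypergraph3 V) (k : nat) :
    bool :=
  [forall P : {set V},
    (#|P| == 2) && [exists e in edges H, P \subset e] ==> (k <= codegree H P)].

(* When H has an edge, the admissible k are bounded by the number of edges, so
   the maximum over k <= #|edges H| is the maximum over all k. *)
Definition min_positive_codegree (V : finType) (H : hypergraph3 V) : nat :=
  if edges H == finset.set0 then 0
  else \max_(k < #|edges H|.+1 | positive_codegree_ge H k) k.

Definition contains_copy (V W : finType) (F : hypergraph3 V)
    (H : hypergraph3 W) : bool :=
  [exists f : {ffun V -> W},
    injectiveb f && ([set f @: (e : {set V}) | e in edges F] \subset edges H)].

Definition coex_plus (V : finType) (F : hypergraph3 V) (n : nat) : nat :=
  \max_(H : hypergraph3 'I_n | ~~ contains_copy F H) min_positive_codegree H.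

(* Main.v *)
(* If some pair lies in an edge and every such pair lies in at least k edges,
   then choosing an edge one vertex at a time gives at least k^3 ordered edges.
   With t = #|V|, the power mean inequality applied to each of the three
   coordinates gives at least n^(3t) (k/n)^(3t^3) homomorphisms from the complete
   3-partite 3-graph K(t,t,t).  When F is 3-partite and H is F-free, each of them
   identifies two vertices of the copy of F inside K(t,t,t), so there are at most
   t^2 n^(3t-1); hence k^(3t^3) n <= t^2 n^(3t^3) and eps = 1/(3t^3) works.  When
   F is not 3-partite, it is not contained in the balanced complete 3-partite
   3-graph, whose minimum positive co-degree is at least floor(n/3). *)
Require Import Defs.
From mathcomp Require Import all_boot all_order all_algebra.
From mathcomp Require Import all_classical all_reals all_analysis.
From mathcomp Require Import zify.
Import Order.TTheory GRing.Theory Num.Theory numFieldNormedType.Exports.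

Set Implicit Arguments.
Unset Strict Implicit.
Unset Printing Implicit Defensive.

Local Open Scope nat_scope.

(** * Power means and the counting of blow-ups *)

(** Rearrangement: [a ^ t] and [b ^ t] are ordered as [a] and [b], so [(b - a) * (b ^ t - a ^ t)] is
    nonnegative. *)
Lemma chebyshev_exp2 (a b t : nat) :
  a ^ t * b + b ^ t * a <= a ^ t.+1 + b ^ t.+1.
Proof.
wlog le_ab : a b / a <= b => [hw|].
  by case/orP: (leq_total a b) => /hw; rewrite // addnC [X in _ <= X]addnC.
rewrite !expnSr -(subnKC le_ab) !mulnDr; set c := b - a.
have : a ^ t * c <= (a + c) ^ t * c
  by rewrite leq_mul2r; case: t => [|t]; rewrite ?leqnn ?orbT // leq_exp2r // leq_addr orbT.
lia.
Qed.

Lemma power_mean (I : finType) (a : I -> nat) (t : nat) :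
  #|I| * (\sum_i a i) ^ t <= #|I| ^ t * \sum_i a i ^ t.
Proof.
elim: t => [|t IH]; first by rewrite !expn0 muln1 mul1n sum_nat_const muln1.
have cheb : (\sum_i a i ^ t) * \sum_i a i <= #|I| * \sum_i a i ^ t.+1.
  (* Summing the two-term inequality over all ordered pairs gives Chebyshev's sum inequality with
     both sides doubled. *)
  have : \sum_i \sum_j (a i ^ t * a j + a j ^ t * a i)
      <= \sum_i \sum_j (a i ^ t.+1 + a j ^ t.+1).
    by do 2!apply: leq_sum => ? _; apply: chebyshev_exp2.
  under eq_bigr do rewrite big_split /= -big_distrr -big_distrl /=.
  under [X in _ <= X]eq_bigr do rewrite big_split /= sum_nat_const.
  rewrite !big_split /= -big_distrl -!big_distrr /= sum_nat_const.
  by rewrite !addnn leq_double.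
rewrite !expnSr mulnA (leq_trans (leq_mul IH (leqnn _))) //.
by rewrite -!mulnA leq_mul2l cheb orbT.
Qed.

(** One coordinate is blown up and the others, packed in [b], stay fixed: after the power mean over
    [b], the power of the inner sum expands into a sum over maps [X]. *)
Lemma sum_blowup (A B V : finType) (chi : A -> B -> nat) :
  #|B| * (\sum_b \sum_a chi a b) ^ #|V|
  <= #|B| ^ #|V| * \sum_b \sum_(X : {ffun V -> A}) \prod_v chi (X v) b.
Proof.
apply: leq_trans (power_mean _ _) _; rewrite leq_mul2l; apply/orP; right.
apply: leq_sum => b _; rewrite -(bigA_distr_bigA (fun _ a => chi a b)).
by rewrite prod_nat_const.
Qed.

Lemma sum_blowup3 (W V : finType) (chi : W -> W -> W -> nat) :
  0 < #|W| ->
  (\sum_x \sum_y \sum_z chi x y z) ^ (#|V| ^ 3) * #|W| ^ (3 * #|V|)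
  <= #|W| ^ (3 * #|V| ^ 3) *
     \sum_(X : {ffun V -> W}) \sum_(Y : {ffun V -> W}) \sum_(Z : {ffun V -> W})
        \prod_a \prod_b \prod_c chi (X a) (Y b) (Z c).
Proof.
set t := #|V|; set n := #|W| => n_gt0.
(* For an edge indicator [chi], [N1], [N2] and [N3] count homomorphisms from K(t,1,1), K(t,t,1) and
   K(t,t,t). *)
pose N1 := \sum_(b : W * W) \sum_(X : {ffun V -> W}) \prod_a chi (X a) b.1 b.2.
pose N2 := \sum_(b : {ffun V -> W} * W) \sum_(Y : {ffun V -> W})
             \prod_v \prod_a chi (b.1 a) (Y v) b.2.
pose N3 := \sum_(b : {ffun V -> W} * {ffun V -> W}) \sum_(Z : {ffun V -> W})
             \prod_c \prod_v \prod_a chi (b.1 a) (b.2 v) (Z c).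
set T := \sum_x _.
have -> : \sum_(X : {ffun V -> W}) \sum_(Y : {ffun V -> W})
    \sum_(Z : {ffun V -> W}) \prod_a \prod_b \prod_c chi (X a) (Y b) (Z c) = N3.
  rewrite pair_bigA; apply: eq_bigr => -[X Y] _ /=; apply: eq_bigr => Z _.
  rewrite [RHS]exchange_big /=.
  under [RHS]eq_bigr do rewrite exchange_big /=.
  by rewrite [RHS]exchange_big.
have TE : T = \sum_(b : W * W) \sum_x chi x b.1 b.2.
  rewrite exchange_big; apply: eq_bigr => x _.
  by rewrite -(pair_bigA _ (fun y z => chi x y z)).
have N1E : N1 = \sum_(b : {ffun V -> W} * W) \sum_y \prod_a chi (b.1 a) y b.2.
  rewrite /N1 -(pair_bigA _ (fun y z =>
    \sum_(X : {ffun V -> W}) \prod_a chi (X a) y z)).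
  rewrite -(pair_bigA _ (fun (X : {ffun V -> W}) z =>
    \sum_y \prod_a chi (X a) y z)) /=.
  under eq_bigr do rewrite exchange_big /=.
  rewrite exchange_big /=; apply: eq_bigr => X _.
  by rewrite exchange_big.
have N2E : N2 = \sum_(b : {ffun V -> W} * {ffun V -> W}) \sum_z
    \prod_v \prod_a chi (b.1 a) (b.2 v) z.
  rewrite /N2 -(pair_bigA _ (fun (X : {ffun V -> W}) z => \sum_(Y : {ffun V -> W})
     \prod_v \prod_a chi (X a) (Y v) z)).
  rewrite -(pair_bigA _ (fun (X Y : {ffun V -> W}) => \sum_z
     \prod_v \prod_a chi (X a) (Y v) z)) /=.
  by apply: eq_bigr => X _; rewrite exchange_big.
have S1 : n ^ 2 * T ^ t <= (n ^ 2) ^ t * N1.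
  rewrite TE -mulnn -card_prod.
  exact: (@sum_blowup W (W * W)%type V (fun x b => chi x b.1 b.2)).
have S2 : n ^ t.+1 * N1 ^ t <= (n ^ t.+1) ^ t * N2.
  rewrite N1E expnSr -card_ffun -card_prod.
  exact: (@sum_blowup W ({ffun V -> W} * W)%type V
    (fun y b => \prod_a chi (b.1 a) y b.2)).
have S3 : n ^ (2 * t) * N2 ^ t <= (n ^ (2 * t)) ^ t * N3.
  rewrite N2E mul2n -addnn expnD -card_ffun -card_prod.
  exact: (@sum_blowup W ({ffun V -> W} * {ffun V -> W})%type V
    (fun z b => \prod_v \prod_a chi (b.1 a) (b.2 v) z)).
have pw s a b : a <= b -> a ^ s <= b ^ s.
  by case: s => // s; rewrite leq_exp2r.
(* These powers make the bounds link up: [T ^ (t ^ 3)], then [N1 ^ (t ^ 2)], [N2 ^ t] and [N3]. *)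
have {S1}S1 := pw (t * t) _ _ S1; have {S2}S2 := pw t _ _ S2.
rewrite (expnMn (n ^ 2)) (expnMn ((n ^ 2) ^ t)) -!expnM in S1.
rewrite !expnMn -!expnM in S2 S3.
(* The chained bounds carry [n] to the power 3t^2 + 3t on the left and 3t^3 + 3t^2 on the right; the
   common 3t^2 is cancelled. *)
have n3_gt0 : 0 < n ^ (3 * t ^ 2) by rewrite expn_gt0 n_gt0.
rewrite -(leq_pmul2l n3_gt0).
have -> : n ^ (3 * t ^ 2) * (T ^ (t ^ 3) * n ^ (3 * t)) =
    n ^ (2 * (t * t)) * T ^ (t * (t * t)) * n ^ (t.+1 * t) * n ^ (2 * t).
  have -> : t * (t * t) = t ^ 3 by rewrite !expnS expn0 muln1.
  rewrite mulnCA -expnD [n ^ _ * T ^ _]mulnC -!mulnA -!expnD.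
  by congr (_ * n ^ _); rewrite mulSn -mulnn; lia.
have -> : n ^ (3 * t ^ 2) * (n ^ (3 * t ^ 3) * N3) =
    n ^ (2 * (t * (t * t))) * (n ^ (t.+1 * t * t) * (n ^ (2 * t * t) * N3)).
  rewrite !mulnA -!expnD; congr (n ^ _ * _).
  by lia.
have chain p q r s u w T' b c N : p * T' <= q * b -> r * b <= s * c ->
    u * c <= w * N -> p * T' * r * u <= q * (s * (w * N)).
  move=> h1 h2 h3; apply: leq_trans (leq_mul (leq_mul h1 (leqnn r)) (leqnn u)) _.
  rewrite -!mulnA leq_mul2l mulnA [b * _]mulnC.
  apply/orP; right; apply: leq_trans (leq_mul h2 (leqnn u)) _.
  by rewrite -mulnA leq_mul2l [c * _]mulnC h3 orbT.
exact: (chain _ _ _ _ _ _ _ _ _ _ S1 S2 S3).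
Qed.

(** * Edges and positive co-degree *)

Lemma card_edge (V : finType) (H : hypergraph3 V) (e : {set V}) :
  e \in edges H -> #|e| = 3.
Proof. by move=> eH; have /forall_inP/(_ e eH)/eqP := edges_card3 H. Qed.

Lemma set3C (V : finType) (u v w : V) : [set u; v; w] = [set u; w; v].
Proof. by apply/setP => x; rewrite !inE orbAC. Qed.

Lemma set3R (V : finType) (u v w : V) : [set u; v; w] = [set v; w; u].
Proof. by apply/setP => x; rewrite !inE -orbA orbC. Qed.

Lemma edge_neq (V : finType) (H : hypergraph3 V) (u v w : V) :
  [set u; v; w] \in edges H -> u != v.
Proof.
move=> /card_edge eH; apply/eqP => uv; move: eH.
by rewrite uv finset.setUid cards2; case: (v != w).
Qed.

Lemma edge_third (V : finType) (H : hypergraph3 V) (e : {set V}) (u v : V) :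
  e \in edges H -> u != v -> [set u; v] \subset e -> exists w, e = [set u; v; w].
Proof.
move=> eH uv uve; have : #|e :\: [set u; v]| == 1.
  by rewrite cardsD (finset.setIidPr uve) cards2 uv (card_edge eH).
case/cards1P => w ew; exists w.
by rewrite -ew finset.setDE finset.setUIr finset.setUCr finset.setIT
  (finset.setUidPr uve).
Qed.

Lemma edge_set3 (V : finType) (H : hypergraph3 V) (e : {set V}) :
  e \in edges H -> exists u v w, e = [set u; v; w].
Proof.
move=> eH; have /card_gt1P[u [v [ue ve uv]]] : 1 < #|e| by rewrite (card_edge eH).
exists u, v; apply: edge_third eH uv _.
by rewrite finset.subUset !finset.sub1set ue ve.
Qed.

Lemma codegree_third (V : finType) (H : hypergraph3 V) (u v : V) :
  u != v -> codegree H [set u; v] <= #|[set w | [set u; v; w] \in edges H]|.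
Proof.
move=> uv; apply: leq_trans (leq_imset_card (fun w => [set u; v; w]) _).
apply: subset_leq_card; apply/fintype.subsetP => e; rewrite inE => /andP[eH uve].
have [w eE] := edge_third eH uv uve.
by apply/imsetP; exists w; rewrite // inE -eE.
Qed.

Lemma third_ge (V : finType) (H : hypergraph3 V) (k : nat) (u v w : V) :
  positive_codegree_ge H k -> [set u; v; w] \in edges H ->
  k <= #|[set w' | [set u; v; w'] \in edges H]|.
Proof.
move=> /forallP/(_ [set u; v]) /implyP kH eH; have uv := edge_neq eH.
apply: leq_trans (codegree_third _ uv); apply: kH.
rewrite cards2 uv /=; apply/exists_inP; exists [set u; v; w] => //.
by apply: finset.subsetUl.
Qed.

Lemma min_positive_codegreeP (V : finType) (H : hypergraph3 V) :
  positive_codegree_ge H (min_positive_codegree H).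
Proof.
rewrite /min_positive_codegree; case: ifP => _; last first.
  (* [maxn] returns one of its arguments and the default 0 is admissible, so the maximum is
     admissible too. *)
  elim/big_ind: _ => // [|m n]; first by apply/forallP => P; rewrite implybT.
  by rewrite /maxn; case: ifP.
by apply/forallP => P; apply/implyP.
Qed.

Lemma leq_min_positive_codegree (V : finType) (H : hypergraph3 V) (k : nat) :
  edges H != finset.set0 -> positive_codegree_ge H k ->
  k <= min_positive_codegree H.
Proof.
move=> H0 kH; rewrite /min_positive_codegree (negbTE H0).
have k_lt : k < #|edges H|.+1.
  have /finset.set0Pn[e eH] := H0.
  have [u [v [w eE]]] := edge_set3 eH; rewrite eE in eH.
  have uv := edge_neq eH.
  move/forallP/(_ [set u; v])/implyP: kH => kH; rewrite ltnS.
  apply: leq_trans (kH _) _.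
    rewrite cards2 uv /=; apply/exists_inP; exists [set u; v; w] => //.
    exact: finset.subsetUl.
  by apply: subset_leq_card; apply/fintype.subsetP => f; rewrite inE => /andP[].
exact: (@leq_bigmax_cond _ (fun k : 'I_#|edges H|.+1 => positive_codegree_ge H k)
   (fun k : 'I__ => k : nat) (Ordinal k_lt)).
Qed.

Lemma leq_sum_set (T : finType) (A : {set T}) (F : T -> nat) (k l : nat) :
  k <= #|A| -> (forall x, x \in A -> l <= F x) -> k * l <= \sum_x F x.
Proof.
move=> kA lF; apply: (@leq_trans (\sum_(x in A) F x)); last first.
  by rewrite [X in _ <= X](bigID (mem A)) /= leq_addr.
apply: (@leq_trans (\sum_(x in A) l)); last exact: leq_sum.
by rewrite sum_nat_const leq_mul2r kA orbT.
Qed.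

(** From a fixed edge uvw, choose x completing the pair uv, then y completing ux, then z completing
    xy: each pair lies in an edge found before, so each choice has at least [k] options. *)
Lemma ordered_edges_ge (V : finType) (H : hypergraph3 V) (k : nat) :
  edges H != finset.set0 -> positive_codegree_ge H k ->
  k ^ 3 <= \sum_x \sum_y \sum_z ([set x; y; z] \in edges H).
Proof.
move=> /finset.set0Pn[e eH] kH.
have [u [v [w eE]]] := edge_set3 eH; rewrite {}eE in eH.
rewrite !expnS muln1; apply: leq_sum_set (third_ge kH eH) _ => x.
rewrite inE set3C => uxH; apply: leq_sum_set (third_ge kH uxH) _ => y.
rewrite inE set3R => xyH; rewrite -[k]muln1.
by apply: leq_sum_set (third_ge kH xyH) _ => z; rewrite inE => ->.
Qed.

(** * Homomorphisms into F-free 3-graphs *)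

Lemma card_ffun_coord_eq (I W : finType) (i j : I) :
  i != j -> #|[set g : {ffun I -> W} | g i == g j]| * #|W| <= #|W| ^ #|I|.
Proof.
(* The coordinate i of g is recovered from g j, so it can be overwritten freely. *)
move=> ij; set A := [set _ | _].
pose upd (p : {ffun I -> W} * W) : {ffun I -> W} :=
  [ffun k => if k == i then p.2 else p.1 k].
have upd_inj : {in finset.setX A [set: W] &, injective upd}.
  move=> [g w] [g' w']; rewrite !inE !andbT /= => /eqP gij /eqP g'ij /ffunP E.
  have Ek k : k != i -> g k = g' k.
    by move=> ki; move: (E k); rewrite !ffunE (negbTE ki).
  congr pair; last by move: (E i); rewrite !ffunE eqxx.
  apply/ffunP => k; have [->|] := eqVneq k i; last exact: Ek.
  by rewrite gij g'ij Ek // eq_sym.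
rewrite -card_ffun -cardsT -cardsX -(card_in_imset upd_inj).
exact: max_card.
Qed.

(** Three vertices with distinct colours use all three colours, so the edge can be listed by class,
    in the order of the parts of K(t,t,t). *)
Lemma rainbow_set3 (V : finType) (c : V -> 'I_3) (e : {set V}) :
  #|e| = 3 -> {in e &, injective c} ->
  exists v : 'I_3 -> V, (forall i, c (v i) = i) /\
    e = [set v ord0; v (inord 1); v ord_max].
Proof.
move=> e3 c_inj; have cT : c @: e = [set: 'I_3].
  by apply/eqP; rewrite eqEcard finset.subsetT (card_in_imset c_inj) e3
    cardsT card_ord.
have cv i : exists v, (v \in e) && (c v == i).
  have : i \in c @: e by rewrite cT inE.
  by case/imsetP => v ve ->; exists v; rewrite ve eqxx.
pose v i := xchoose (cv i); exists v.
have vE i : v i \in e /\ c (v i) = i by have /andP[? /eqP] := xchooseP (cv i).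
split=> [i|]; first exact: (vE i).2.
have vne i j : i != j -> v i != v j.
  by apply: contraNneq => vij; rewrite -(vE i).2 -(vE j).2 vij.
apply/eqP; rewrite eq_sym eqEcard e3 !finset.subUset !finset.sub1set !(vE _).1 /=.
rewrite [X in _ < X](_ : _ = 3) //.
have [n01 n02 n12] : [/\ ord0 != inord 1 :> 'I_3, ord0 != ord_max :> 'I_3
    & inord 1 != ord_max :> 'I_3].
  by rewrite -!val_eqE /= inordK.
rewrite finset.setUC cardsU1 cards2 (vne _ _ n01) !inE eq_sym (negbTE (vne _ _ n02)).
by rewrite eq_sym (negbTE (vne _ _ n12)).
Qed.

Lemma tripartite_injP (V : finType) (F : hypergraph3 V) :
  reflect (exists c : V -> 'I_3, forall e, e \in edges F -> {in e &, injective c})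
    (tripartite F).
Proof.
apply: (iffP existsP) => [[c /forall_inP cF]|[c cF]].
  exists c => e eF u v ue ve cuv.
  have /forallP/(_ (c u)) := cF e eF; move/card_le1_eqP; apply.
    by rewrite !inE ve cuv /=.
  by rewrite !inE ue /=.
exists (finfun c); apply/forall_inP => e eF; apply/forallP => i.
apply/card_le1_eqP => u v; rewrite !inE !ffunE.
move=> /andP[ue /eqP cu] /andP[ve /eqP cv].
by apply: (cF e eF) => //; rewrite cu cv.
Qed.

(* The vertex (i, v) of K(t,t,t) is the copy of v in class i; g lists the maps on
   classes 0, 1 and 2 in this order. *)
Definition glue (V W : finType)
    (g : {ffun V -> W} * ({ffun V -> W} * {ffun V -> W})) : {ffun 'I_3 * V -> W} :=
  [ffun p => if p.1 == ord0 then g.1 p.2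
             else if p.1 == ord_max then g.2.2 p.2 else g.2.1 p.2].

Lemma glue_inj (V W : finType) : injective (@glue V W).
Proof.
move=> [X [Y Z]] [X' [Y' Z']] /ffunP E.
congr (_, (_, _)); apply/ffunP => v.
- by move: (E (ord0, v)); rewrite !ffunE.
- by move: (E (inord 1, v)); rewrite !ffunE /= -!val_eqE /= inordK.
- by move: (E (ord_max, v)); rewrite !ffunE.
Qed.

(** [F] sits inside K(t,t,t) through [v] mapped to [(c v, v)]; a homomorphism injective on these
    vertices would give a copy of [F] in [H]. *)
Lemma free_glueN (V W : finType) (F : hypergraph3 V) (H : hypergraph3 W)
    (c : V -> 'I_3) (g : {ffun V -> W} * ({ffun V -> W} * {ffun V -> W})) :
  (forall e, e \in edges F -> {in e &, injective c}) -> ~~ contains_copy F H ->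
  (forall u v w, [set g.1 u; g.2.1 v; g.2.2 w] \in edges H) ->
  exists u v, u != v /\ glue g (c u, u) = glue g (c v, v).
Proof.
move=> cF FfreeH gH; pose f := [ffun v => glue g (c v, v)].
have /injectivePn[u [v uv fuv]] : ~~ injectiveb f; last first.
  by exists u, v; split=> //; move: fuv; rewrite !ffunE.
apply: contra FfreeH => f_inj; apply/existsP; exists f; rewrite f_inj /=.
apply/fintype.subsetP => _ /imsetP[e eF ->].
have [v [cv ->]] := rainbow_set3 (card_edge eF) (cF e eF).
by rewrite !imsetU !imset_set1 !ffunE !cv /= -!val_eqE /= inordK //=.
Qed.

(** A union bound over the pairs of distinct vertices of [F] that may be identified; each
    identification costs a factor [#|W|] among all maps from K(t,t,t). *)
Lemma homs_free_le (V W : finType) (F : hypergraph3 V) (H : hypergraph3 W) :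
  tripartite F -> ~~ contains_copy F H ->
  (\sum_(X : {ffun V -> W}) \sum_(Y : {ffun V -> W}) \sum_(Z : {ffun V -> W})
     \prod_a \prod_b \prod_c ([set X a; Y b; Z c] \in edges H : nat)) * #|W|
  <= #|V| ^ 2 * #|W| ^ (3 * #|V|).
Proof.
move=> /tripartite_injP[c cF] FfreeH.
pose A (p : V * V) :=
  [set g : {ffun 'I_3 * V -> W} | g (c p.1, p.1) == g (c p.2, p.2)].
pose G := ({ffun V -> W} * ({ffun V -> W} * {ffun V -> W}))%type.
pose hom (g : G) : nat :=
  \prod_a \prod_b \prod_d ([set g.1 a; g.2.1 b; g.2.2 d] \in edges H : nat).
(* [hom g] is 0 or 1, and when it is 1 some identified pair contributes 1 on the right. *)
have hom_le (g : G) : hom g <= \sum_(p : V * V | p.1 != p.2) (glue g \in A p).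
  have [/eqP|hom_neq0] := boolP (hom g == 0); first by move->.
  have gH u v w : [set g.1 u; g.2.1 v; g.2.2 w] \in edges H.
    apply: contraNT hom_neq0 => /negbTE uvwN.
    by rewrite /hom (bigD1 u) //= (bigD1 v) //= (bigD1 w) //= uvwN.
  have [u [v [uv guv]]] := free_glueN cF FfreeH gH.
  apply: (@leq_trans 1); last by rewrite (bigD1 (u, v)) //= inE guv eqxx.
  have prod_le1 (f : V -> nat) : (forall v, f v <= 1) -> \prod_v f v <= 1.
    by move=> f1; elim/big_ind: _ => // m n m1 n1; apply: (@leq_mul _ _ 1 1).
  by do 3!apply: (prod_le1) => ?; case: (_ \in _).
have A_le p : p.1 != p.2 -> #|A p| * #|W| <= #|W| ^ (3 * #|V|).
  have <- : #|{: 'I_3 * V}| = 3 * #|V| by rewrite card_prod card_ord.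
  move=> p12.
  by apply: card_ffun_coord_eq; apply: contraNneq p12 => -[_ ->].
have -> : \sum_(X : {ffun V -> W}) \sum_(Y : {ffun V -> W}) \sum_(Z : {ffun V -> W})
     \prod_a \prod_b \prod_c ([set X a; Y b; Z c] \in edges H : nat) = \sum_g hom g.
  rewrite -(pair_bigA _ (fun X YZ => hom (X, YZ))) /=; apply: eq_bigr => X _.
  by rewrite -(pair_bigA _ (fun Y Z => hom (X, (Y, Z)))).
apply: (@leq_trans ((\sum_(g : G)
    \sum_(p : V * V | p.1 != p.2) (glue g \in A p)) * #|W|)).
  by rewrite leq_mul2r leq_sum ?orbT.
rewrite exchange_big /= big_distrl /=.
apply: (@leq_trans (\sum_(p : V * V | p.1 != p.2) #|W| ^ (3 * #|V|))).
  apply: leq_sum => p p12; apply: leq_trans (A_le p p12); rewrite leq_mul2r.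
  apply/orP; right; apply: (@leq_trans #|[set g | glue g \in A p]|).
    rewrite -sum1_card [X in _ <= X]big_mkcond /=; apply: leq_sum => g _.
    rewrite [g \in _]inE. by case: (_ \in _).
  rewrite -(card_imset _ (@glue_inj V W)); apply: subset_leq_card.
  by apply/fintype.subsetP => _ /imsetP[g gA ->]; move: gA; rewrite inE.
by rewrite sum_nat_const leq_mul2r -mulnn -card_prod max_card orbT.
Qed.

Lemma free_codegree_le (V W : finType) (F : hypergraph3 V) (H : hypergraph3 W) :
  0 < #|W| -> tripartite F -> ~~ contains_copy F H ->
  min_positive_codegree H ^ (3 * #|V| ^ 3) * #|W|
  <= #|V| ^ 2 * #|W| ^ (3 * #|V| ^ 3).
Proof.
move=> W_gt0 Ftri FfreeH; set t := #|V|; set n := #|W|.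
set k := min_positive_codegree H.
(* Without edges the co-degree is 0 by convention, which suffices if the exponent is positive; if
   [V] is empty, the empty map is a copy of [F], contradicting freeness. *)
have [H0|H0] := boolP (edges H == finset.set0).
  have [t0|t_gt0] := posnP t.
    case/negP: FfreeH; apply/existsP.
    have V0 (v : V) : False by move: (max_card (pred1 v)); rewrite -/t t0 card1.
    exists [ffun v => False_rect W (V0 v)]; apply/andP; split.
      by apply/injectiveP => v; case: (V0 v).
    apply/fintype.subsetP => _ /imsetP[e eF ->].
    by have [v] := edge_set3 eF; case: (V0 v).
  rewrite /k /min_positive_codegree H0 exp0n ?mul0n //.
  by rewrite muln_gt0 expn_gt0 t_gt0.
have T_ge : k ^ 3 <= _ := ordered_edges_ge H0 (min_positive_codegreeP H).
have blow := @sum_blowup3 W V (fun x y z => [set x; y; z] \in edges H : nat) W_gt0.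
have homs := homs_free_le Ftri FfreeH.
have n3t_gt0 : 0 < n ^ (3 * t) by rewrite expn_gt0 W_gt0.
rewrite -(leq_pmul2r n3t_gt0).
move: blow homs; set T := \sum_x _; set N := \sum_X _; rewrite -/t -/n => blow homs.
have kT : k ^ (3 * t ^ 3) <= T ^ (t ^ 3).
  by rewrite expnM; case: (t ^ 3) => // m; rewrite leq_exp2r.
apply: (@leq_trans (T ^ (t ^ 3) * n ^ (3 * t) * n)).
  by rewrite mulnAC leq_mul2r leq_mul2r kT !orbT.
apply: leq_trans (leq_mul blow (leqnn _)) _.
rewrite -mulnA.
apply: leq_trans (leq_mul (leqnn _) homs) _.
by rewrite mulnCA mulnA.
Qed.

(** * Complete 3-partite 3-graphs *)

Definition complete_tripartite_edges (W : finType) (c : W -> 'I_3) : {set {set W}} :=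
  [set e : {set W} | (#|e| == 3) && (#|c @: e| == 3)].

Lemma complete_tripartite_card3 (W : finType) (c : W -> 'I_3) :
  [forall e in complete_tripartite_edges c, #|e| == 3].
Proof. by apply/forall_inP => e; rewrite inE => /andP[]. Qed.

Definition complete_tripartite (W : finType) (c : W -> 'I_3) : hypergraph3 W :=
  Hypergraph3 (complete_tripartite_card3 c).

Lemma complete_tripartite_set3 (W : finType) (c : W -> 'I_3) (u v w : W) :
  ([set u; v; w] \in edges (complete_tripartite c))
  = [&& c u != c v, c u != c w & c v != c w].
Proof.
have card_set3 (T : finType) (x y z : T) :
    (#|[set x; y; z]| == 3) = [&& x != y, x != z & y != z].
  rewrite finset.setUC cardsU1 cards2 !inE !negb_or ![z == _]eq_sym.
  by case: (x != y); case: (x != z); case: (y != z).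
rewrite inE !imsetU !imset_set1 !card_set3 andbC.
apply: andb_idr => /and3P[uv uw vw].
have neq x y : c x != c y -> x != y by apply: contraNneq => ->.
by rewrite !neq.
Qed.

(** The colouring [c] pulls back along the embedding. *)
Lemma copy_tripartite (V W : finType) (F : hypergraph3 V) (c : W -> 'I_3) :
  contains_copy F (complete_tripartite c) -> tripartite F.
Proof.
case/existsP => f /andP[/injectiveP f_inj /fintype.subsetP FH].
apply/tripartite_injP; exists (c \o f) => e eF.
have := FH _ (imset_f _ eF); rewrite inE => /andP[fe3 cfe3].
by apply/imset_injP; rewrite imset_comp (eqP cfe3) (card_edge eF).
Qed.

(** A pair inside an edge has two colours, and every vertex of the third class completes it.
    Positivity of [k] makes all classes non-empty, so an edge exists. *)
Lemma complete_tripartite_codegree (W : finType) (c : W -> 'I_3) (k : nat) :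
  0 < k -> (forall i, k <= #|[set w | c w == i]|) ->
  k <= min_positive_codegree (complete_tripartite c).
Proof.
move=> k_gt0 kc; have rep i : exists w, w \in [set w | c w == i].
  by apply/finset.set0Pn; rewrite -card_gt0 (leq_trans k_gt0).
apply: leq_min_positive_codegree.
  have [u] := rep ord0; have [v] := rep (inord 1); have [w] := rep ord_max.
  rewrite !inE => /eqP cw /eqP cv /eqP cu.
  apply/finset.set0Pn; exists [set u; v; w].
  by rewrite complete_tripartite_set3 cu cv cw -!val_eqE /= inordK.
apply/forallP => P; apply/implyP.
move=> /andP[/cards2P[u [v [uv ->]]] /exists_inP[e eH uve]].
have [w eE] := edge_third eH uv uve; move: eH; rewrite eE complete_tripartite_set3.
case/and3P => cuv cuw cvw; apply: leq_trans (kc (c w)) _.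
have inj : {in [set w' | c w' == c w] &, injective (fun w' => [set u; v; w'])}.
  move=> x y; rewrite !inE => /eqP cx /eqP cy xy.
  have : x \in [set u; v; y] by rewrite -xy !inE eqxx orbT.
  by rewrite !inE => /orP[/orP[]|] /eqP // xE; rewrite -cx xE eqxx in cuw cvw.
rewrite -(card_in_imset inj); apply: subset_leq_card.
apply/fintype.subsetP => _ /imsetP[x xw ->]; move: xw; rewrite inE => /eqP cx.
rewrite inE complete_tripartite_set3 cx cuv cuw cvw; exact: finset.subsetUl.
Qed.

(** The numbers [3 * j + i] with [j < n %/ 3] are below [n] and have residue [i]. *)
Lemma class_mod3_ge (n : nat) (i : 'I_3) :
  n %/ 3 <= #|[set w : 'I_n | inord (w %% 3) == i :> 'I_3]|.
Proof.
have lt_n (j : 'I_(n %/ 3)) : 3 * j + i < n.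
  by have := ltn_ord j; have := ltn_ord i; lia.
have inj : injective (fun j => Ordinal (lt_n j)).
  by move=> j j' /(congr1 val) /= E; apply: val_inj => /=; lia.
rewrite -{1}(card_ord (n %/ 3)) -(card_imset _ inj); apply: subset_leq_card.
apply/fintype.subsetP => _ /imsetP[j _ ->]; rewrite inE /= mulnC modnMDl.
by rewrite modn_small ?inord_val.
Qed.

(** * Bounds for fixed n *)

Lemma min_positive_codegree_le (V : finType) (H : hypergraph3 V) :
  min_positive_codegree H <= #|V|.
Proof.
have [H0|/finset.set0Pn[e eH]] := boolP (edges H == finset.set0).
  by rewrite /min_positive_codegree H0.
have [u [v [w eE]]] := edge_set3 eH; rewrite eE in eH.
by apply: leq_trans (third_ge (min_positive_codegreeP H) eH) (max_card _).
Qed.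

Lemma coex_plus_le (V : finType) (F : hypergraph3 V) (n : nat) : coex_plus F n <= n.
Proof.
apply/bigmax_leqP => H _.
by rewrite -[X in _ <= X]card_ord min_positive_codegree_le.
Qed.

Lemma coex_plus_ge (V : finType) (F : hypergraph3 V) (n : nat) :
  2 < n -> ~~ tripartite F -> n %/ 3 <= coex_plus F n.
Proof.
move=> n_gt2 FN; pose c (w : 'I_n) : 'I_3 := inord (w %% 3).
apply: leq_trans (@complete_tripartite_codegree _ c (n %/ 3) _ (class_mod3_ge n)) _.
  by rewrite divn_gt0.
apply: (@leq_bigmax_cond _ (fun H : hypergraph3 'I_n => ~~ contains_copy F H)
  (fun H => min_positive_codegree H)).
by apply: contra FN; apply: copy_tripartite.
Qed.

(** The value 0 is that of a maximum over an empty family. When [V] is empty the inequality reads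
    [n <= 0] and fails, so this alternative must hold. *)
Lemma coex_plus_tripartite_le (V : finType) (F : hypergraph3 V) (n : nat) :
  0 < n -> tripartite F ->
  coex_plus F n = 0 \/
  coex_plus F n ^ (3 * #|V| ^ 3) * n <= #|V| ^ 2 * n ^ (3 * #|V| ^ 3).
Proof.
move=> n_gt0 Ftri; rewrite /coex_plus.
elim/big_ind: _ => [|k l ? ?|H FH]; first by left.
  by rewrite /maxn; case: ifP.
right; have := @free_codegree_le V 'I_n F H; rewrite card_ord; exact.
Qed.

(** * Asymptotic form *)

Local Open Scope classical_set_scope.
Local Open Scope ring_scope.

Lemma le_powR_root (R : realType) (K C k n : nat) :
  (0 < K)%N -> (0 < n)%N -> (k ^ K * n <= C * n ^ K)%N ->
  k%:R <= C%:R * n%:R `^ (1 - K%:R^-1) :> R.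
Proof.
move=> K_gt0 n_gt0 kn.
have n0 : 0 < n%:R :> R by rewrite ltr0n.
(* A K-th root would produce the constant [C] to the power 1/K; this bound allows [C] itself. *)
have C1 : (C <= C ^ K)%N
  by case: (C) => [//|c]; rewrite -[X in (X <= _)%N]expn1 leq_pexp2l.
rewrite -(ler_pXn2r K_gt0) ?nnegrE ?mulr_ge0 ?powR_ge0 //.
rewrite exprMn -[X in _ * X]powR_mulrn ?powR_ge0 // -powRrM mulrBl mul1r.
rewrite mulVf ?pnatr_eq0 -?lt0n // powRB ?(gt_eqF n0) ?implybT //.
rewrite powRr1 ?(ltW n0) // powR_mulrn ?(ltW n0) // mulrA.
rewrite ler_pdivlMr // -!natrX -!natrM ler_nat.
by apply: leq_trans kn _; rewrite leq_mul2r C1 orbT.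
Qed.

Theorem theorem25 (R : realType) (V : finType) (F : hypergraph3 V) :
  (tripartite F ->
    exists2 eps : R, 0 < eps &
      (fun n : nat => (coex_plus F n)%:R : R^o) =O_\oo
      (fun n : nat => n%:R `^ (1 - eps) : R^o)) /\
  (~~ tripartite F ->
    (fun n : nat => (coex_plus F n)%:R : R^o) =Theta_\oo
    (fun n : nat => n%:R : R^o)).
Proof.
split=> [Ftri|FN].
  (* With no vertices 1/(3t^3) is undefined; then [coex_plus F n] vanishes for positive [n] and any
     positive exponent, here 1, serves. *)
  have [V0|V_gt0] := posnP #|V|.
    exists 1 => //; apply/eqO_exP; exists 1 => //; near=> n.
    have n_gt0 : (0 < n)%N by near: n; exact: nbhs_infty_gt.
    have -> : coex_plus F n = 0%N.
      case: (coex_plus_tripartite_le n_gt0 Ftri) => //.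
      by rewrite V0 /= muln0 !expn0 mul1n leqNgt n_gt0.
    by rewrite normr0 mulr_ge0.
  have K_gt0 : (0 < 3 * #|V| ^ 3)%N by rewrite muln_gt0 expn_gt0 V_gt0.
  exists (3 * #|V| ^ 3)%:R^-1; first by rewrite invr_gt0 ltr0n.
  apply/eqO_exP; exists (#|V| ^ 2)%:R; first by rewrite ltr0n expn_gt0 V_gt0.
  near=> n.
  have n_gt0 : (0 < n)%N by near: n; exact: nbhs_infty_gt.
  rewrite ger0_norm // ger0_norm ?powR_ge0 //.
  case: (coex_plus_tripartite_le n_gt0 Ftri) => [->|]; last exact: le_powR_root.
  by rewrite mulr_ge0 ?powR_ge0.
rewrite eqThetaE bigThetaE eqOmegaO; split; apply/eqO_exP.
  exists 1 => //; near=> n.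
  by rewrite !ger0_norm // mul1r ler_nat coex_plus_le.
(* For n at least 3, floor(n/3) is at least 1, so n is at most 3 floor(n/3) + 2, hence at most 5
   floor(n/3). *)
exists 5 => //; near=> n.
have n_gt2 : (2 < n)%N by near: n; exact: nbhs_infty_gt.
have := coex_plus_ge n_gt2 FN => n3.
rewrite !ger0_norm // -natrM ler_nat; lia.
Unshelve. all: by end_near. Qed.
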